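(* Let $G=(\mathcal{N},\mathcal{L})$ be a finite connected simple graph and let $r>0$. Let $\mathbf{x}^\star$ be a mixed stationary state, with set of consensus links $\mathcal{L}_{=}$, of the system $\frac{dx_k}{dt}=\sum_{l\sim k}\left[r(x_k-x_l)-(x_k-x_l)^3\right]$ on $G$. Let $\omega_{ij}$ denote the effective resistance between $i$ and $j$ in $G$. Then: if $\sum_{(i,j)\in\mathcal{L}_{=}}\omega_{ij}<2/3$, $\mathbf{x}^\star$ is stable; if $\max_{(i,j)\in\mathcal{L}_{=}}\omega_{ij}>2/3$, $\mathbf{x}^\star$ is unstable.
   Context: $G=(\mathcal{N},\mathcal{L})$ is an undirected graph with $N$ nodes, without self-loops or multiple links; $i\sim j$ means that $i$ and $j$ are linked, and each undirected link is counted once in $\mathcal{L}$. The system is $\frac{dx_i}{dt}=\sum_{j\sim i}\left[r(x_i-x_j)-(x_i-x_j)^3\right]$ for all nodes $i$, with system parameter $r\in\mathbb{R}$. The state space is $X=\mathbb{R}^N/\mathbf{1}$: two states are identified if they differ by a constant vector. A stationary state is a state $\mathbf{x}^\star$ at which all right-hand sides vanish. A detailed-balance stationary state is a state $\mathbf{x}^\star$ with $x_i^\star-x_j^\star\in\{0,\pm\sqrt r\}$ for all $i\sim j$. Such states are stationary. A link with difference $0$ is a consensus link, and a link with difference $\pm\sqrt r$ is a dissensus link; $\mathcal{L}_{=}$ denotes the set of consensus links of $\mathbf{x}^\star$. A mixed stationary state is a detailed-balance stationary state having both consensus and dissensus links. Stability is meant in the linear sense. Let $J(\mathbf{x}^\star)$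 be the (symmetric) $N\times N$ Jacobian matrix of the right-hand side at $\mathbf{x}^\star$; the constant vector is always in its kernel. The state $\mathbf{x}^\star$ is stable if $J(\mathbf{x}^\star)$ is negative definite on the orthogonal complement of the constant vector, and unstable if $J(\mathbf{x}^\star)$ has at least one positive eigenvalue. The Laplacian $Q$ of $G$ has entries $Q_{ii}=d_i$ (the degree of $i$), $Q_{ij}=-1$ if $i\sim j$, and $0$ otherwise. The effective resistance is $\omega_{ij}=(\mathbf{e}_i-\mathbf{e}_j)^TQ^\dagger(\mathbf{e}_i-\mathbf{e}_j)$, with $Q^\dagger$ the Moore–Penrose pseudoinverse of $Q$ and $\mathbf{e}_i$ the standard unit vectors. *)

(* Defs.v *)
From HB Require Import structures.
From mathcomp Require Import all_boot all_order all_algebra.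
From mathcomp Require Import boolp classical_sets reals topology normedtype derive.

Set Implicit Arguments.
Unset Strict Implicit.
Unset Printing Implicit Defensive.

Import Order.TTheory GRing.Theory Num.Theory.
Import numFieldNormedType.Exports.

Local Open Scope ring_scope.

Section PseudoInverse.
Variable R : realType.

(* The four Penrose equations; the transpose is the adjoint, as R is real. *)
Definition penrose m n (A : 'M[R]_(m, n)) (X : 'M[R]_(n, m)) : Prop :=
  [/\ A *m X *m A = A, X *m A *m X = X,
      (A *m X)^T = A *m X & (X *m A)^T = X *m A].

(* pinvP and pinv_unique below show that the default value 0 is never used. *)
Definition pinv m n (A : 'M[R]_(m, n)) : 'M[R]_(n, m) :=
  xget 0 [set X | penrose A X]%classic.

Lemma gram_eq0 n (v : 'rV[R]_n) : v *m v^T = 0 -> v = 0.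
Proof.
move=> /matrixP/(_ 0 0); rewrite !mxE => /eqP.
rewrite psumr_eq0 => [/allP h|i _]; last by rewrite mxE -expr2 sqr_ge0.
apply/rowP => i; have := h i (mem_index_enum _).
by rewrite !mxE -expr2 sqrf_eq0 => /eqP.
Qed.

Lemma gram_unit m n (A : 'M[R]_(m, n)) : row_free A -> A *m A^T \in unitmx.
Proof.
move=> fA; rewrite -row_free_unit; apply/row_freeP.
suff : kermx (A *m A^T) = 0.
  by move/eqP; rewrite kermx_eq0 => /row_freeP.
apply/row_matrixP => i; rewrite row0.
have : row i (kermx (A *m A^T)) *m (A *m A^T) = 0.
  by rewrite -row_mul mulmx_ker row0.
move: (row i _) => u hu.
have : (u *m A) *m (u *m A)^T = 0.
  by rewrite trmx_mul mulmxA -(mulmxA u) hu mul0mx.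
move/gram_eq0 => huA; apply: (row_free_inj fA); by rewrite huA mul0mx.
Qed.

Lemma penrose_full_rank m n k (C : 'M[R]_(m, k)) (F : 'M[R]_(k, n)) :
  row_full C -> row_free F ->
  penrose (C *m F) (F^T *m invmx (F *m F^T) *m invmx (C^T *m C) *m C^T).
Proof.
move=> fC fF; have uF := gram_unit fF.
have uC : C^T *m C \in unitmx.
  by rewrite -{2}[C]trmxK; apply: gram_unit; rewrite /row_free mxrank_tr.
set P := invmx (F *m F^T); set S := invmx (C^T *m C).
have PT : P^T = P by rewrite trmx_inv trmx_mul trmxK.
have ST : S^T = S by rewrite trmx_inv trmx_mul trmxK.
have AX : C *m F *m (F^T *m P *m S *m C^T) = C *m S *m C^T.
  by rewrite !mulmxA -(mulmxA C F) -(mulmxA C _ P) mulmxV // mulmx1.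
have XA : F^T *m P *m S *m C^T *m (C *m F) = F^T *m P *m F.
  by rewrite !mulmxA -(mulmxA _ C^T C) -(mulmxA _ S) mulVmx // mulmx1.
split.
- by rewrite AX !mulmxA -(mulmxA _ C^T C) -(mulmxA _ S) mulVmx // mulmx1.
- by rewrite XA !mulmxA -(mulmxA _ F F^T) -(mulmxA _ _ P) mulmxV // mulmx1.
- by rewrite AX !trmx_mul trmxK ST mulmxA.
- by rewrite XA !trmx_mul trmxK PT mulmxA.
Qed.

Lemma penrose_exists m n (A : 'M[R]_(m, n)) : exists X, penrose A X.
Proof.
have := penrose_full_rank (col_base_full A) (row_base_free A).
by rewrite mulmx_base => hA; eexists; exact: hA.
Qed.

Lemma pinvP m n (A : 'M[R]_(m, n)) : penrose A (pinv A).
Proof. by have [X hX] := penrose_exists A; exact: (xgetI 0 hX). Qed.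

Lemma penrose_unique m n (A : 'M[R]_(m, n)) X Y :
  penrose A X -> penrose A Y -> X = Y.
Proof.
move=> [x1 x2 x3 x4] [y1 y2 y3 y4].
have e1 : A *m X = A *m Y.
  by rewrite -{1}y1 -(mulmxA _ A X) -y3 -x3 -trmx_mul mulmxA x1 y3.
have e2 : X *m A = Y *m A.
  by rewrite -{1}y1 -(mulmxA A) mulmxA -x4 -y4 -trmx_mul -mulmxA (mulmxA A) x1.
by rewrite -x2 e2 -mulmxA e1 mulmxA y2.
Qed.

Lemma pinv_unique m n (A : 'M[R]_(m, n)) X : penrose A X -> pinv A = X.
Proof. by move=> hX; apply: penrose_unique hX; exact: pinvP. Qed.

End PseudoInverse.

Section System.
Variables (R : realType) (N : nat).

(* A graph on N nodes is given by its adjacency relation. *)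
Definition simple_graph (G : rel 'I_N) : Prop := symmetric G /\ irreflexive G.

Definition connected_graph (G : rel 'I_N) : Prop := forall i j, connect G i j.

(* Each undirected link is represented once, by its pair (i, j) with i < j. *)
Definition links (G : rel 'I_N) : {set 'I_N * 'I_N} :=
  [set p : 'I_N * 'I_N | (p.1 < p.2)%N && G p.1 p.2].

Definition laplacian (G : rel 'I_N) : 'M[R]_N :=
  \matrix_(i, j) if i == j then #|[set k | G i k]|%:R
                 else if G i j then -1 else 0.

Definition unit_vec (i : 'I_N) : 'cV[R]_N := delta_mx i 0.

Definition eff_res (G : rel 'I_N) (i j : 'I_N) : R :=
  ((unit_vec i - unit_vec j)^T *m pinv (laplacian G)
     *m (unit_vec i - unit_vec j)) 0 0.

(* A state, i.e. a class in R^N / 1, is given by a representative x : 'rV_N;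
   every notion below is invariant under adding a constant vector to x. *)
Definition rhs (G : rel 'I_N) (r : R) (x : 'rV[R]_N) : 'rV[R]_N :=
  \row_i \sum_(j | G i j) (r * (x 0 i - x 0 j) - (x 0 i - x 0 j) ^+ 3).

Definition stationary (G : rel 'I_N) (r : R) (x : 'rV[R]_N) : Prop :=
  rhs G r x = 0.

Definition detailed_balance (G : rel 'I_N) (r : R) (x : 'rV[R]_N) : Prop :=
  forall i j, G i j ->
    x 0 i - x 0 j \in [:: 0; Num.sqrt r; - Num.sqrt r].

Lemma detailed_balance_stationary (G : rel 'I_N) (r : R) (x : 'rV[R]_N) :
  0 <= r -> detailed_balance G r x -> stationary G r x.
Proof.
move=> r0 db; apply/rowP => i; rewrite !mxE big1 // => j /db; rewrite !inE.
have s3 : Num.sqrt r ^+ 3 = r * Num.sqrt r by rewrite exprSr sqr_sqrtr.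
case/or3P => /eqP ->; first by rewrite mulr0 expr0n subrr.
  by rewrite s3 subrr.
by rewrite exprNn s3 -signr_odd expr1 mulN1r mulrN opprK addNr.
Qed.

Definition consensus_links (G : rel 'I_N) (x : 'rV[R]_N) : {set 'I_N * 'I_N} :=
  [set p : 'I_N * 'I_N in links G | x 0 p.1 - x 0 p.2 == 0].

Definition dissensus_links (G : rel 'I_N) (r : R) (x : 'rV[R]_N) :
    {set 'I_N * 'I_N} :=
  [set p : 'I_N * 'I_N in links G | x 0 p.1 - x 0 p.2 \in [:: Num.sqrt r; - Num.sqrt r]].

Definition mixed_stationary (G : rel 'I_N) (r : R) (x : 'rV[R]_N) : Prop :=
  [/\ detailed_balance G r x, consensus_links G x != finset.set0
    & dissensus_links G r x != finset.set0].

(* 'J is the Jacobian for the action on row vectors: entry (i, j) is the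
   derivative of coordinate j of the right-hand side with respect to x_i.  The
   transpose restores the usual convention. *)
Definition jac (G : rel 'I_N) (r : R) (x : 'rV[R]_N) : 'M[R]_N :=
  ('J (rhs G r) x)^T.

Definition stable (G : rel 'I_N) (r : R) (x : 'rV[R]_N) : Prop :=
  forall v : 'cV[R]_N, (const_mx 1 : 'rV[R]_N) *m v = 0 -> v != 0 ->
    (v^T *m jac G r x *m v) 0 0 < 0.

Definition unstable (G : rel 'I_N) (r : R) (x : 'rV[R]_N) : Prop :=
  exists2 a : R, 0 < a & eigenvalue (jac G r x) a.

End System.

(* Main.v *)
Require Import Defs.
From mathcomp Require Import all_boot all_order all_algebra.
From mathcomp Require Import boolp functions reals topology normedtype derive.
From mathcomp Require Import complex ring lra.

Import Order.TTheory GRing.Theory Num.Theory.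
Import numFieldNormedType.Exports.

Local Open Scope ring_scope.

(** A link with difference [d] enters the Jacobian with weight [r - 3 d^2],
    which is [r] on consensus links and [- 2 r] on dissensus links.  Hence
    (lemma [jac_energy]) the quadratic form of the Jacobian is
      [v^T J v = 3 r S(v) - 2 r E(v)],
    where [E(v)] is the sum of [(v_i - v_j)^2] over all links and [S(v)] the
    same sum over the consensus links only.

    The effective resistance is the best constant in
      [(v_i - v_j)^2 <= omega_ij E(v)].
    Indeed [w = Q^+ (e_i - e_j)] solves [Q w = e_i - e_j] on a connected graph,
    so pairing with [w] in the Dirichlet form is evaluation of [v_i - v_j]
    (lemma [eff_res_potential]), and the Dirichlet norm of [w] is [omega_ij];
    the bound is then the Cauchy-Schwarz inequality, with equality at [v = w].

    Stability: the bound gives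
      [v^T J v <= r (3 sum omega_ij - 2) E(v)],
    the sum being over consensus links, and [E(v) > 0] for a nonzero [v] of
    zero sum, since a vector without energy is constant on a connected graph.

    Instability: for a consensus link [(i, j)] the potential [w] has
    [S(w) >= (w_i - w_j)^2 = omega_ij^2] and [E(w) = omega_ij], so that
    [w^T J w >= r omega_ij (3 omega_ij - 2) > 0]; a symmetric matrix whose form
    takes a positive value has a positive eigenvalue
    ([sym_pos_eigenvalue]). *)

Set Implicit Arguments.
Unset Strict Implicit.

(** * Symmetric matrices with a positive value *)

Section Spectral.
Local Open Scope sesquilinear_scope.

Lemma hermitian_form_spectral (C : numClosedFieldType) n (A : 'M[C]_n)
    (w : 'cV[C]_n) : A \is hermsymmx ->
  (w^t* *m A *m w) 0 0 =
    \sum_i spectral_diag A 0 i * `|(spectralmx A *m w) i 0| ^+ 2.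
Proof.
move=> /hermitian_normalmx /orthomx_spectralP A_eq.
rewrite {1}A_eq invmx_unitary ?spectral_unitarymx //.
set P := spectralmx A; set d := spectral_diag A.
have -> : w^t* *m (P^t* *m diag_mx d *m P) *m w
    = (P *m w)^t* *m diag_mx d *m (P *m w).
  by rewrite trmx_mul map_mxM /= !mulmxA.
rewrite mxE; apply: eq_bigr => i _; rewrite mul_mx_diag !mxE normCK.
by rewrite [X in _ = _ * X]mulrC mulrCA mulrA.
Qed.

(** The rows of the diagonalizing matrix are eigenvectors. *)
Lemma spectral_diag_eigenvalue (C : numClosedFieldType) n (A : 'M[C]_n) i :
  A \is normalmx -> eigenvalue A (spectral_diag A 0 i).
Proof.
move=> /orthomx_spectralP A_eq; set P := spectralmx A in A_eq *.
have uP : P \in unitmx by exact: spectral_unit.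
apply/eigenvalueP; exists (row i P).
  rewrite -row_mul {1}A_eq !mulmxA mulmxV // mul1mx row_mul row_diag_mx.
  by rewrite -scalemxAl -rowE.
apply: contraTneq uP => Pi0; rewrite -row_free_unit; apply/negP => /row_freeP[B].
move=> /(congr1 (row i)) /rowP /(_ i); rewrite row_mul Pi0 mul0mx !mxE eqxx /=.
by move/eqP; rewrite eq_sym oner_eq0.
Qed.

(** Over [R[i]] the matrix is unitarily diagonalizable with a real diagonal, and
    its form at [v] is a combination of the diagonal entries with nonnegative
    coefficients, so one of them is positive.  It is an eigenvalue over [R] as
    well, because the characteristic polynomial commutes with the embedding. *)
Lemma sym_pos_eigenvalue (R : rcfType) n (A : 'M[R]_n) (v : 'cV[R]_n) :
  A^T = A -> 0 < (v^T *m A *m v) 0 0 -> exists2 a, 0 < a & eigenvalue A a.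
Proof.
move=> A_sym vAv_gt0.
pose toC := real_complex R.
pose M : 'M[R[i]]_n := map_mx toC A.
have hM : M \is hermsymmx.
  apply: realsym_hermsym.
    apply/is_hermitianmxP.
    by rewrite expr0 scale1r map_mx_id // /M map_trmx A_sym.
  by apply/mxOverP => i j; rewrite mxE complex_real.
pose w := map_mx toC v.
have form_w : (w^t* *m M *m w) 0 0 = toC ((v^T *m A *m v) 0 0).
  have -> : w^t* = map_mx toC v^T.
    by apply/matrixP => i j; rewrite !mxE; apply/CrealP; rewrite complex_real.
  by rewrite -!map_mxM mxE.
have d_real i : spectral_diag M 0 i \is Num.real.
  by have /mxOverP/(_ 0 i) := hermitian_spectral_diag_real hM.
have [i di_gt0] : exists i, 0 < spectral_diag M 0 i.
  apply/existsP; apply: contraTT vAv_gt0 => /existsPn d_le0.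
  rewrite -leNgt -lecR -/toC -form_w hermitian_form_spectral //.
  apply: sumr_le0 => i _; rewrite mulr_le0_ge0 ?exprn_ge0 //.
  by rewrite real_leNgt ?d_le0.
have /complex_realP[a di_eq] := d_real i.
exists a; first by rewrite -ltcR -di_eq.
have := spectral_diag_eigenvalue i (hermitian_normalmx hM).
by rewrite di_eq !eigenvalue_root_char -map_char_poly fmorph_root.
Qed.

End Spectral.

(** * Weighted Laplacians *)

(** The cases [w = 1] and [w i j = r - 3 (x_i - x_j)^2] are the Laplacian of the
    graph and the Jacobian of the system.  Describing the matrix by its action
    rather than by its entries lets the derivative along a vector be used as it
    comes. *)
Definition is_weighted_laplacian (R : pzRingType) N (G : rel 'I_N)
    (w : 'I_N -> 'I_N -> R) (A : 'M[R]_N) :=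
  forall (v : 'cV[R]_N) i,
    (A *m v) i 0 = \sum_(j | G i j) w i j * (v i 0 - v j 0).

(** Summation by parts: each link occurs in both directions on the left, and
    the two terms combine. *)
Lemma sum_links_by_parts (R : comPzRingType) N (G : rel 'I_N)
    (w : 'I_N -> 'I_N -> R) (u v : 'I_N -> R) :
  simple_graph G -> (forall i j, w i j = w j i) ->
  \sum_i u i * (\sum_(j | G i j) w i j * (v i - v j)) =
  \sum_(p in links G) w p.1 p.2 * ((u p.1 - u p.2) * (v p.1 - v p.2)).
Proof.
move=> [G_sym G_irr] w_sym.
under eq_bigr do rewrite mulr_sumr.
rewrite pair_big_dep /= (bigID (fun p : 'I_N * 'I_N => (p.1 < p.2)%N)) /=.
rewrite [X in _ + X](reindex_inj (inv_inj (@swap_pairK _ _))) /=.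
have -> : \sum_(p : 'I_N * 'I_N | G p.2 p.1 && ~~ (p.2 < p.1)%N)
      u p.2 * (w p.2 p.1 * (v p.2 - v p.1))
    = \sum_(p in links G) u p.2 * (w p.2 p.1 * (v p.2 - v p.1)).
  apply: eq_bigl => -[i j]; rewrite inE /= -leqNgt leq_eqVlt andbC G_sym.
  by case: eqP => [/val_inj ->|//]; rewrite G_irr !andbF.
have -> : \sum_(p : 'I_N * 'I_N | G p.1 p.2 && (p.1 < p.2)%N)
      u p.1 * (w p.1 p.2 * (v p.1 - v p.2))
    = \sum_(p in links G) u p.1 * (w p.1 p.2 * (v p.1 - v p.2)).
  by apply: eq_bigl => p; rewrite inE andbC.
rewrite -big_split; apply: eq_bigr => -[i j] _ /=.
by rewrite (w_sym j i); ring.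
Qed.

Lemma weighted_laplacian_form (R : comPzRingType) N (G : rel 'I_N)
    (w : 'I_N -> 'I_N -> R) (A : 'M[R]_N) (u v : 'cV[R]_N) :
  simple_graph G -> (forall i j, w i j = w j i) ->
  is_weighted_laplacian G w A ->
  (u^T *m A *m v) 0 0 =
  \sum_(p in links G)
    w p.1 p.2 * ((u p.1 0 - u p.2 0) * (v p.1 0 - v p.2 0)).
Proof.
move=> G_simple w_sym Aw.
rewrite -(sum_links_by_parts (fun i => u i 0) (fun i => v i 0)) //.
rewrite -mulmxA mxE; apply: eq_bigr => i _.
by rewrite mxE Aw.
Qed.

Lemma weighted_laplacian_sym (R : comNzRingType) N (G : rel 'I_N)
    (w : 'I_N -> 'I_N -> R) (A : 'M[R]_N) :
  simple_graph G -> (forall i j, w i j = w j i) ->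
  is_weighted_laplacian G w A -> A^T = A.
Proof.
move=> G_simple w_sym Aw.
have entry i j :
    A i j = ((delta_mx i 0 : 'cV_N)^T *m A *m (delta_mx j 0 : 'cV_N)) 0 0.
  by rewrite trmx_delta -rowE -colE !mxE.
apply/matrixP => i j; rewrite mxE !entry.
rewrite !(weighted_laplacian_form _ _ G_simple w_sym Aw).
by apply: eq_bigr => p _; rewrite [X in _ * X]mulrC.
Qed.

Lemma laplacian_weighted (R : realType) N (G : rel 'I_N) :
  simple_graph G -> is_weighted_laplacian G (fun _ _ => 1) (laplacian R G).
Proof.
move=> [_ G_irr] v i; rewrite mxE.
under [RHS]eq_bigr do rewrite mul1r.
rewrite sumrB sumr_const.
transitivity (\sum_j ((if i == j then #|[set k | G i k]|%:R * v j 0 else 0)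
   - (if G i j then v j 0 else 0))).
  apply: eq_bigr => j _; rewrite mxE.
  case: eqP => [<-|_]; first by rewrite G_irr subr0.
  by case: ifP => _; rewrite ?mulN1r ?mul0r ?subr0 ?sub0r.
rewrite sumrB -!big_mkcond /=; congr (_ - _).
rewrite (big_pred1 i) => [|j]; last by rewrite eq_sym.
by rewrite mulr_natl cardsE.
Qed.

(** * Energy and effective resistance *)

(** Expanding the sum of the squares of [B a_i - C b_i], with [B] the sum of the
    [b_i^2] and [C] that of the [a_i b_i], yields the inequality multiplied
    by [B]. *)
Lemma cauchy_schwarz_sum (R : realFieldType) (I : finType) (P : {pred I})
    (a b : I -> R) :
  (\sum_(i in P) a i * b i) ^+ 2 <=
    (\sum_(i in P) a i ^+ 2) * (\sum_(i in P) b i ^+ 2).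
Proof.
set A := \sum_(i in P) a i ^+ 2; set B := \sum_(i in P) b i ^+ 2.
set C := \sum_(i in P) a i * b i.
have B_ge0 : 0 <= B by apply: sumr_ge0 => i _; exact: sqr_ge0.
have [B_gt0|B_le0] := ltP 0 B.
  have expand s t : \sum_(i in P) (s * a i - t * b i) ^+ 2
      = s ^+ 2 * A - 2 * s * t * C + t ^+ 2 * B.
    rewrite /A /B /C !mulr_sumr -sumrB -big_split.
    by apply: eq_bigr => i _ /=; ring.
  have : 0 <= \sum_(i in P) (B * a i - C * b i) ^+ 2.
    by apply: sumr_ge0 => i _; exact: sqr_ge0.
  have -> : \sum_(i in P) (B * a i - C * b i) ^+ 2 = B * (A * B - C ^+ 2).
    by rewrite expand; ring.
  by rewrite pmulr_rge0 // subr_ge0.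
have B0 : B = 0 by apply/eqP; rewrite eq_le B_le0.
have b0 i : i \in P -> b i = 0.
  move=> iP; apply/eqP; rewrite -sqrf_eq0; apply/eqP.
  by apply: (psumr_eq0P _ B0) => // k _; exact: sqr_ge0.
have -> : C = 0 by apply: big1 => i /b0 ->; rewrite mulr0.
by rewrite B0 mulr0 expr0n.
Qed.

Lemma connected_const (T : Type) N (G : rel 'I_N) (f : 'I_N -> T) :
  connected_graph G -> (forall i j, G i j -> f i = f j) -> forall i j, f i = f j.
Proof.
move=> G_conn fG i j; have /connectP[p p_path ->] := G_conn i j.
elim: p i p_path => //= k p IHp i /andP[/fG -> /IHp ->//].
Qed.

Lemma energy_eq0_const (R : realType) N (G : rel 'I_N) (v : 'cV[R]_N) :
  simple_graph G -> connected_graph G ->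
  \sum_(p in links G) (v p.1 0 - v p.2 0) ^+ 2 = 0 ->
  forall i j, v i 0 = v j 0.
Proof.
move=> [G_sym G_irr] G_conn E0.
have link_eq (i j : 'I_N) : (i < j)%N -> G i j -> v i 0 = v j 0.
  move=> ij Gij; apply/eqP; rewrite -subr_eq0 -sqrf_eq0; apply/eqP.
  have sq_ge0 (p : 'I_N * 'I_N) : p \in links G -> 0 <= (v p.1 0 - v p.2 0) ^+ 2.
    by move=> _; exact: sqr_ge0.
  by have /= := psumr_eq0P sq_ge0 E0 (i := (i, j)); rewrite inE /= ij Gij; apply.
apply: (connected_const (f := fun i => v i 0) G_conn) => i j Gij.
have [ij|ji|/val_inj ij] := ltngtP i j; first exact: link_eq.
  by rewrite (link_eq j i) // G_sym.
by rewrite ij.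
Qed.

(** The vector [w] is the electric potential [Q^+ (e_i - e_j)] of a unit current
    from [i] to [j]: its Dirichlet pairing with [v] is
    [v^T Q w = v^T (e_i - e_j)].  Since [Q Q^+] is a symmetric projection with
    the same range as [Q], the equation [Q w = e_i - e_j] amounts to
    [1 - Q Q^+] annihilating [e_i - e_j]: its columns are in the kernel of [Q],
    hence constant on a connected graph. *)
Lemma eff_res_potential (R : realType) N (G : rel 'I_N) i j :
  simple_graph G -> connected_graph G ->
  exists w : 'cV[R]_N,
    w i 0 - w j 0 = eff_res R G i j /\
    forall v : 'cV[R]_N,
      \sum_(p in links G) (w p.1 0 - w p.2 0) * (v p.1 0 - v p.2 0)
        = v i 0 - v j 0.
Proof.
move=> G_simple G_conn.
set Q := laplacian R G; set b := unit_vec R i - unit_vec R j.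
have Q_op := laplacian_weighted (R := R) G_simple.
have Q_form (u v : 'cV[R]_N) : (u^T *m Q *m v) 0 0 =
    \sum_(p in links G) (u p.1 0 - u p.2 0) * (v p.1 0 - v p.2 0).
  rewrite (weighted_laplacian_form u v G_simple _ Q_op) //.
  by apply: eq_bigr => p _; rewrite mul1r.
have Q_sym : Q^T = Q by exact: weighted_laplacian_sym Q_op.
have [QXQ _ QX_sym _] := Defs.pinvP Q; set X := Defs.pinv Q in QXQ QX_sym.
have dotb (u : 'cV[R]_N) : (u^T *m b) 0 0 = u i 0 - u j 0.
  by rewrite /b mulmxBr /unit_vec -!colE !mxE.
have bdot (u : 'cV[R]_N) : (b^T *m u) 0 0 = u i 0 - u j 0.
  by rewrite -dotb -[in RHS](trmxK b) -trmx_mul [RHS]mxE.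
have QXb : Q *m (X *m b) = b.
  pose Z := 1%:M - Q *m X.
  have Z_sym : Z^T = Z by rewrite linearB /= trmx1 QX_sym.
  have QZ : Q *m Z = 0.
    have : (Z *m Q)^T = 0 by rewrite mulmxBl mul1mx QXQ subrr trmx0.
    by rewrite trmx_mul Q_sym Z_sym.
  suff : Z *m b = 0.
    by rewrite mulmxBl mul1mx -mulmxA => /eqP; rewrite subr_eq0 => /eqP.
  apply/colP => k; rewrite [RHS]mxE -[Z]Z_sym.
  have -> : (Z^T *m b) k 0 = ((col k Z)^T *m b) 0 0.
    by rewrite tr_col -row_mul [RHS]mxE.
  rewrite dotb; apply/eqP; rewrite subr_eq0; apply/eqP.
  apply: (energy_eq0_const G_simple G_conn).
  under eq_bigr do rewrite expr2.
  by rewrite -Q_form -mulmxA (colE k Z) (mulmxA Q) QZ mul0mx mulmx0 mxE.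
exists (X *m b); split; first by rewrite -bdot mulmxA.
move=> v; rewrite -dotb -[in RHS]QXb (mulmxA v^T Q) Q_form.
by apply: eq_bigr => p _; rewrite mulrC.
Qed.

(** Cauchy-Schwarz for the pairing of [v] with the potential, whose own energy
    is the effective resistance. *)
Lemma sqr_diff_le_eff_res (R : realType) N (G : rel 'I_N) i j (v : 'cV[R]_N) :
  simple_graph G -> connected_graph G ->
  (v i 0 - v j 0) ^+ 2 <=
    eff_res R G i j * \sum_(p in links G) (v p.1 0 - v p.2 0) ^+ 2.
Proof.
move=> G_simple G_conn.
have [w [w_res w_dot]] := eff_res_potential R i j G_simple G_conn.
rewrite -w_dot -w_res -(w_dot w).
exact: cauchy_schwarz_sum.
Qed.

(** * The Jacobian *)

(** The conditional sum becomes a total one in the ring of functions, the form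
    in which the differentiation rules for sums apply. *)
Lemma rhs_coordE (R : realType) N (G : rel 'I_N) r i :
  let c k : 'rV[R]_N -> R := fun y => y 0 k in
  (fun y => rhs G r y 0 i)
    = \sum_j (G i j)%:R *: (r *: (c i - c j) - (c i - c j) ^+ 3).
Proof.
apply/funext => y; rewrite mxE fct_sumE big_mkcond; apply: eq_bigr => j _.
by rewrite -[RHS]/(_ * _); case: ifP => _; rewrite ?mul1r ?mul0r.
Qed.

Lemma is_derive_coord (R : realType) n (x v : 'rV[R]_n) k :
  is_derive x v (fun y : 'rV[R]_n => y 0 k) (v 0 k).
Proof.
have idx : derivable (id : 'rV[R]_n -> 'rV[R]_n) x v by exact: derivable_id.
apply: DeriveDef; first exact: (derivable_mxP _ _ _).1 idx 0 k.
by rewrite -[in RHS](derive_id x v) (derive_mx idx) mxE.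
Qed.

Lemma is_derive_rhs_coord (R : realType) N (G : rel 'I_N) r (x v : 'rV[R]_N) i :
  is_derive x v (fun y => rhs G r y 0 i)
    (\sum_(j | G i j) (r - 3 * (x 0 i - x 0 j) ^+ 2) * (v 0 i - v 0 j)).
Proof.
rewrite rhs_coordE [X in is_derive _ _ _ X]big_mkcond.
apply: is_derive_sum => j.
pose c k (y : 'rV[R]_N) : R := y 0 k.
have dc k : is_derive x v (c k) (v 0 k) by exact: is_derive_coord.
rewrite -/(c i) -/(c j); apply: is_derive_eq.
rewrite -[LHS]/(_ * _).
by case: ifP => _; rewrite ?mul1r ?mul0r // mulrBl.
Qed.

(** The Jacobian is defined from the total differential, so directional
    derivatives do not determine it without this. *)
Lemma differentiable_rhs (R : realType) N (G : rel 'I_N) r (x : 'rV[R]_N) :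
  differentiable (rhs G r) x.
Proof.
have -> : rhs G r
    = \sum_i (fun y => rhs G r y 0 i *: (delta_mx 0 i : 'rV[R]_N)).
  by apply/funext => y; rewrite fct_sumE [LHS]row_sum_delta.
apply: differentiable_sum => i; apply: differentiableZl.
rewrite rhs_coordE; apply: differentiable_sum => j.
have dc k : differentiable (fun y : 'rV[R]_N => y 0 k) x.
  exact: differentiable_coord.
apply: differentiableZ; apply: differentiableB.
  by apply: differentiableZ; apply: differentiableB.
by apply: differentiableX; apply: differentiableB.
Qed.

Lemma jac_weighted (R : realType) N (G : rel 'I_N) r (x : 'rV[R]_N) :
  is_weighted_laplacian G (fun i j => r - 3 * (x 0 i - x 0 j) ^+ 2)
    (jac G r x).
Proof.
move=> v i; have dr := differentiable_rhs G r x.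
rewrite /jac -[v]trmxK -trmx_mul mxE -deriveEjacobian // derive_mx; last first.
  exact: diff_derivable.
rewrite mxE; have [_ ->] := is_derive_rhs_coord G r x v^T i.
by apply: eq_bigr => j _; rewrite !mxE.
Qed.

Lemma jac_sym (R : realType) N (G : rel 'I_N) r (x : 'rV[R]_N) :
  simple_graph G -> (jac G r x)^T = jac G r x.
Proof.
move=> G_simple; apply: weighted_laplacian_sym G_simple _ (jac_weighted G r x).
by move=> i j; rewrite -sqrrN opprB.
Qed.

(** The weight [r - 3 d^2] is [3 r - 2 r] on a consensus link and [- 2 r] on a
    dissensus link. *)
Lemma jac_energy (R : realType) N (G : rel 'I_N) r (x : 'rV[R]_N)
    (v : 'cV[R]_N) :
  simple_graph G -> 0 <= r -> detailed_balance G r x ->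
  (v^T *m jac G r x *m v) 0 0 =
    3 * r * \sum_(p in consensus_links G x) (v p.1 0 - v p.2 0) ^+ 2
    - 2 * r * \sum_(p in links G) (v p.1 0 - v p.2 0) ^+ 2.
Proof.
move=> G_simple r_ge0 x_db.
rewrite (weighted_laplacian_form _ _ G_simple _ (jac_weighted G r x)); last first.
  by move=> i j; rewrite -sqrrN opprB.
have -> : \sum_(p in consensus_links G x) (v p.1 0 - v p.2 0) ^+ 2
    = \sum_(p in links G)
        (if x 0 p.1 - x 0 p.2 == 0 then (v p.1 0 - v p.2 0) ^+ 2 else 0).
  by rewrite -big_mkcondr; apply: eq_bigl => p; rewrite !inE.
rewrite !mulr_sumr -sumrB; apply: eq_bigr => -[i j] /=.
rewrite inE /= => /andP[_ Gij].
have [->|d_neq0] := eqVneq (x 0 i - x 0 j) 0; first by ring.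
have -> : (x 0 i - x 0 j) ^+ 2 = r.
  have := x_db i j Gij; rewrite !inE (negbTE d_neq0) /=.
  by case/orP => /eqP ->; rewrite ?sqrrN sqr_sqrtr.
by ring.
Qed.

(** * Stability and instability *)

Lemma stable_of_sum_eff_res (R : realType) N (G : rel 'I_N) r (x : 'rV[R]_N) :
  simple_graph G -> connected_graph G -> 0 < r -> detailed_balance G r x ->
  \sum_(p in consensus_links G x) eff_res R G p.1 p.2 < 2 / 3 ->
  stable G r x.
Proof.
move=> G_simple G_conn r_gt0 x_db res_lt v v_perp v_neq0.
rewrite jac_energy ?ltW //; set E := \sum_(p in links G) _.
have E_gt0 : 0 < E.
  rewrite lt_neqAle eq_sym sumr_ge0 ?andbT => [|p _]; last exact: sqr_ge0.
  apply: contraNneq v_neq0 => /(energy_eq0_const G_simple G_conn) v_const.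
  apply/eqP/colP => i; rewrite mxE.
  have := congr1 (fun M : 'M_1 => M 0 0) v_perp; rewrite !mxE.
  under eq_bigr do rewrite mxE mul1r (v_const _ i).
  rewrite sumr_const card_ord => /eqP; rewrite mulrn_eq0.
  by rewrite gtn_eqF ?(leq_ltn_trans _ (ltn_ord i)) //= => /eqP.
have cons_le : \sum_(p in consensus_links G x) (v p.1 0 - v p.2 0) ^+ 2
    <= (\sum_(p in consensus_links G x) eff_res R G p.1 p.2) * E.
  rewrite mulr_suml; apply: ler_sum => p _.
  exact: sqr_diff_le_eff_res.
rewrite -(ltr_pM2r E_gt0) in res_lt.
have := le_lt_trans cons_le res_lt; set S := \sum_(p in _) _ => S_lt.
have -> : 3 * r * S - 2 * r * E = 3 * r * (S - 2 / 3 * E) by field.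
by rewrite pmulr_rlt0 ?subr_lt0 // mulr_gt0.
Qed.

(** The potential of the link is a test vector of positive value. *)
Lemma unstable_of_eff_res (R : realType) N (G : rel 'I_N) r (x : 'rV[R]_N) p :
  simple_graph G -> connected_graph G -> 0 < r -> detailed_balance G r x ->
  p \in consensus_links G x -> 2 / 3 < eff_res R G p.1 p.2 ->
  unstable G r x.
Proof.
move=> G_simple G_conn r_gt0 x_db p_cons res_gt.
have [w [w_res w_dot]] := eff_res_potential R p.1 p.2 G_simple G_conn.
apply: (sym_pos_eigenvalue (v := w)); first exact: jac_sym.
rewrite jac_energy ?ltW //.
have -> : \sum_(q in links G) (w q.1 0 - w q.2 0) ^+ 2 = eff_res R G p.1 p.2.
  by rewrite -w_res -w_dot; apply: eq_bigr => q _; rewrite expr2.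
have : eff_res R G p.1 p.2 ^+ 2
    <= \sum_(q in consensus_links G x) (w q.1 0 - w q.2 0) ^+ 2.
  rewrite (bigD1 p) //= w_res lerDl; apply: sumr_ge0 => q _; exact: sqr_ge0.
move: res_gt; set o := eff_res _ _ _ _; set S := \sum_(q in _) _ => o_gt o2_le.
have : 0 < r * (o * (3 * o - 2)) by rewrite !mulr_gt0 //; lra.
nra.
Qed.

Unset Implicit Arguments.
Set Strict Implicit.

(* The maximum over the (nonempty) set of consensus links is taken with base
   value 0: effective resistances are nonnegative. *)
Theorem proposition2 (R : realType) (N : nat) (G : rel 'I_N) (r : R)
    (x : 'rV[R]_N) (G_simple : simple_graph G) (G_conn : connected_graph G)
    (r_gt0 : 0 < r) (x_mixed : mixed_stationary G r x) :
  (\sum_(p in consensus_links G x) eff_res R G p.1 p.2 < 2 / 3 ->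
     stable G r x)
  /\ (2 / 3 < \big[Num.max/0]_(p in consensus_links G x) eff_res R G p.1 p.2 ->
        unstable G r x).
Proof.
have [x_db _ _] := x_mixed; split; first exact: stable_of_sum_eff_res.
move=> max_gt.
have [p p_cons res_gt] : exists2 p, p \in consensus_links G x
    & 2 / 3 < eff_res R G p.1 p.2.
  apply/exists_inP; apply: contraTT max_gt; rewrite negb_exists_in => /forall_inP.
  move=> res_le; rewrite -leNgt; apply: bigmax_le => [|p p_cons].
    by rewrite divr_ge0.
  by rewrite leNgt res_le.
exact: unstable_of_eff_res p_cons res_gt.
Qed.
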